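(* Let $\mathbf{X}=\{\mathcal{X}_0,\mathcal{X}_1\}$ be a pair of pseudolattices which admits differentiation and let $\bar B=(B_0,B_1)$ be a Banach pair. Suppose that (i) $\mathcal{J}_0(\bar B)\subset\mathcal{J}(\mathbf{X},\bar B)$ and $\mathcal{J}_0(\bar B)$ is dense in $\mathcal{J}(\mathbf{X},\bar B)$, and that (ii) the right-shift operator $S$, $S(\{b_n\}_{n\in\mathbb{Z}})=\{b_{n-1}\}_{n\in\mathbb{Z}}$, maps $\mathcal{X}_j(B_j)$ boundedly into itself for $j=0,1$. Then, for each $x\in B_0\cap B_1$ and each $s\in\mathbb{A}^\circ$, $$\|x\|_{\bar B_{\mathbf{X},s}}=\inf\Big\{\big\|\{b_n\}_{n\in\mathbb{Z}}\big\|_{\mathcal{J}(\mathbf{X},\bar B)}:\ \sum_{n\in\mathbb{Z}}s^n b_n=x,\ \{b_n\}_{n\in\mathbb{Z}}\in\mathcal{J}_0(\bar B)\Big\}.$$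
   Context: All Banach spaces are over $\mathbb{C}$; $Ban$ denotes the class of all of them. A Banach pair $\bar B=(B_0,B_1)$ consists of two Banach spaces continuously embedded in some Hausdorff topological vector space; $B_0\cap B_1$ and $B_0+B_1$ carry their usual norms. Pseudolattice: a mapping $\mathcal{X}:Ban\to Ban$ such that (i) for each $B\in Ban$ the space $\mathcal{X}(B)$ consists of $B$-valued sequences $\{b_n\}_{n\in\mathbb{Z}}$; (ii) whenever $A$ is a closed subspace of $B$, $\mathcal{X}(A)$ is a closed subspace of $\mathcal{X}(B)$; (iii) there is a constant $C(\mathcal{X})>0$ such that for all $A,B\in Ban$, all bounded linear $T:A\to B$ and every $\{a_n\}_{n\in\mathbb{Z}}\in\mathcal{X}(A)$, the sequence $\{Ta_n\}_{n\in\mathbb{Z}}$ is in $\mathcal{X}(B)$ and $\|\{Ta_n\}\|_{\mathcal{X}(B)}\le C(\mathcal{X})\|T\|_{A\to B}\|\{a_n\}\|_{\mathcal{X}(A)}$. For a pair $\mathbf{X}=\{\mathcal{X}_0,\mathcal{X}_1\}$ of pseudolattices and a Banach pair $\bar B$, $\mathcal{J}(\mathbf{X},\bar B)$ is the space of all $B_0\cap B_1$-valued sequences $\{b_n\}_{n\in\mathbb{Z}}$ such that $\{e^{jn}b_n\}_{n\in\mathbb{Z}}\in\mathcal{X}_j(B_j)$ for $j=0,1$, normed by $\|\{b_n\}\|_{\mathcal{J}(\mathbf{X},\bar B)}=\max_{j=0,1}\|\{e^{jn}b_n\}_{n\in\mathbb{Z}}\|_{\mathcal{X}_j(B_j)}$.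 $\mathcal{J}_0(\bar B)$ is the space of all $B_0\cap B_1$-valued sequences $\{b_n\}_{n\in\mathbb{Z}}$ with finite support. $\mathbb{A}=\{z\in\mathbb{C}:1\le|z|\le e\}$, and $\mathbb{A}^\circ$ is its interior. $\mathbf{X}$ is nontrivial if, for the pair $(\mathbb{C},\mathbb{C})$ and each $s\in\mathbb{A}^\circ$, there is a sequence $\{b_n\}\in\mathcal{J}(\mathbf{X},(\mathbb{C},\mathbb{C}))$ such that $\lim_{M,N\to+\infty}\sum_{n=-M}^N s^nb_n$ exists and is finite and nonzero. $\mathbf{X}$ is Laurent compatible if it is nontrivial and, for every Banach pair $\bar B$, every $\{b_n\}\in\mathcal{J}(\mathbf{X},\bar B)$ and every fixed $z\in\mathbb{A}^\circ$, the Laurent series $\sum_{n\in\mathbb{Z}}z^nb_n$ converges in $B_0+B_1$ and $\|\sum_{n\in\mathbb{Z}}z^nb_n\|_{B_0+B_1}\le C\|\{b_n\}\|_{\mathcal{J}(\mathbf{X},\bar B)}$ for some constant $C=C(z)$ independent of $\{b_n\}$. For $\mathbf{X}$ Laurent compatible and $s\in\mathbb{A}^\circ$, $\bar B_{\mathbf{X},s}$ is the space of all elements $b=\sum_{n\in\mathbb{Z}}s^nb_n$ with $\{b_n\}\in\mathcal{J}(\mathbf{X},\bar B)$, normed by $\|b\|_{\bar B_{\mathbf{X},s}}=\inf\{\|\{b_n\}\|_{\mathcal{J}(\mathbf{X},\bar B)}: b=\sum_{n\in\mathbb{Z}}s^nb_n\}$. $\mathbf{X}$ admits differentiation if it is Laurent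 compatible and, for each complex Banach space $B$: (i) for each $r\in(0,1)$, each $\{b_n\}\in\mathcal{X}_0(B)$ satisfies $\lim_{k\to-\infty}r^{-k}\|b_k\|_B=0$ and each $\{b_n\}\in\mathcal{X}_1(B)$ satisfies $\lim_{k\to\infty}r^k\|b_k\|_B=0$; (ii) for every $\rho\in\mathbb{C}$ with $0<|\rho|<1$ and every $\{b_n\}\in\mathcal{X}_0(B)\cap\mathcal{X}_1(B)$, the sequence $\{b_n^j\}_{n\in\mathbb{Z}}$ is in $\mathcal{X}_j(B)$ for $j=0,1$, where $b_n^0=\sum_{k<0}\rho^{-k}b_{n+k+1}$ and $b_n^1=\sum_{k\ge0}\rho^kb_{n+k+1}$ (these sums converge in $B$ by (i)); (iii) for $j=0,1$ and each such $\rho$, the linear map $D_{j,\rho}$ defined on $\mathcal{X}_j(B)$ by $D_{j,\rho}(\{b_n\}_{n\in\mathbb{Z}})=\{b_n^j\}_{n\in\mathbb{Z}}$ maps $\mathcal{X}_j(B)$ boundedly into itself. *)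

(* Defs.v *)
From HB Require Import structures.
From mathcomp Require Import all_boot all_order all_algebra.
From mathcomp Require Import complex.
From mathcomp Require Import all_classical all_reals all_analysis.

Set Implicit Arguments.
Unset Strict Implicit.
Unset Printing Implicit Defensive.

Import Order.TTheory GRing.Theory Num.Theory.
Import numFieldNormedType.Exports.

Local Open Scope classical_set_scope.
Local Open Scope complex_scope.
Local Open Scope ring_scope.

(* The complex field is R[i] with R : realType, and a
   complex Banach space is a completeNormedModType R[i].  Ban being a large
   class, quantification over it is quantification over this structure. *)

Section ComplexComplete.
Variable R : realType.

Lemma complex_normE (z : R[i]) :
  `|z| = (Num.sqrt (complex.Re z ^+ 2 + complex.Im z ^+ 2))%:C.
Proof. by case: z. Qed.

Lemma complex_norm_leD (z : R[i]) :
  `|z| <= (`|complex.Re z| + `|complex.Im z|)%:C.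
Proof.
rewrite complex_normE lecR -[leRHS]ger0_norm ?addr_ge0// -sqrtr_sqr.
rewrite ler_wsqrtr// sqrrD !real_normK ?num_real//.
by rewrite -addrA [X in _ <= _ + X]addrC lerD2l lerDl mulrn_wge0// mulr_ge0.
Qed.

Lemma Re_norm_le (z : R[i]) : `|complex.Re z| <= complex.Re `|z|.
Proof. by rewrite complex_normE /= -sqrtr_sqr ler_wsqrtr// lerDl sqr_ge0. Qed.

Lemma Im_norm_le (z : R[i]) : `|complex.Im z| <= complex.Re `|z|.
Proof. by rewrite complex_normE /= -sqrtr_sqr ler_wsqrtr// lerDr sqr_ge0. Qed.

Lemma complex_complete (F : set_system R[i]^o) :
  ProperFilter F -> cauchy F -> cvg F.
Proof.
move=> FF /cauchyP Fc.
have part (f : R[i]^o -> R) : (forall z w, f (z - w) = f z - f w) ->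
    (forall z : R[i], `|f z| <= complex.Re `|z|) -> cvg (f @ F).
  move=> fB fle; apply: R_complete; apply/cauchyP => e e0.
  have e0' : 0 < e%:C :> R[i] by rewrite ltcR.
  have [z Fz] := Fc _ e0'.
  exists (f z); suff : F (f @^-1` ball (f z) e) by [].
  apply: filterS Fz => w.
  rewrite -ball_normE /= [X in X < _]complex_normE ltcR => h.
  rewrite /ball /= -fB.
  by rewrite (le_lt_trans (fle _))// complex_normE.
have /cvg_ex[a Fa] : cvg ((@complex.Re R : R[i]^o -> R) @ F).
  by apply: part => [[? ?] [? ?]//|]; exact: Re_norm_le.
have /cvg_ex[b Fb] : cvg ((@complex.Im R : R[i]^o -> R) @ F).
  by apply: part => [[? ?] [? ?]//|]; exact: Im_norm_le.
apply/cvg_ex; exists (a +i* b : R[i]^o).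
apply/(@cvgrPdist_lt _ R[i]^o) => e; rewrite ltcE /= => /andP[/eqP e1 e2].
have -> : e = (complex.Re e)%:C by case: e e1 {e2} => x y /= ->.
have d0 : 0 < complex.Re e / 2 by rewrite divr_gt0.
move/cvgrPdist_lt : Fa => /(_ _ d0) Fa; move/cvgrPdist_lt : Fb => /(_ _ d0) Fb.
near=> z; apply: le_lt_trans (complex_norm_leD _) _.
rewrite ltcR [ltRHS]splitr ltrD//.
  have -> : complex.Re ((a +i* b) - z) = a - complex.Re z by case: (z).
  by near: z.
have -> : complex.Im ((a +i* b) - z) = b - complex.Im z by case: (z).
by near: z.
Unshelve. all: by end_near. Qed.

(* Packed by hand: the canonical complete structure on _^o is already the one
   of realType. *)
Definition complex_banach : completeNormedModType R[i] :=
  HB.pack R[i]^o (Uniform_isComplete.Build R[i]^o complex_complete).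

End ComplexComplete.

(* The norm of a normedModType R[i] takes values in R[i]; rnorm is the same
   number seen in R. *)
Definition rnorm (R : realType) (E : normedModType R[i]) (x : E) : R :=
  complex.Re `|x|.

Definition op_bounded (R : realType) (A B : normedModType R[i]) (T : A -> B) :=
  exists M : R, forall a, rnorm (T a) <= M * rnorm a.

Definition op_norm (R : realType) (A B : normedModType R[i]) (T : A -> B) : R :=
  sup [set rnorm (T a) | a in [set a : A | rnorm a <= 1]].

(* The two spaces of a couple are indexed by j : bool, with false read as 0 and
   true as 1.  The embeddings bp_emb make them subspaces of bp_amb. *)
Record banach_pair (R : realType) := BanachPair {
  bp_amb :> topologicalLmodType R[i];
  bp_hausdorff : hausdorff_space bp_amb;
  bp_sp : bool -> completeNormedModType R[i];
  bp_emb : forall j, {linear bp_sp j -> bp_amb};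
  bp_emb_inj : forall j, injective (bp_emb j);
  bp_emb_continuous : forall j, continuous (bp_emb j)
}.

Definition complex_pair (R : realType) : banach_pair R :=
  {| bp_amb := R[i]^o;
     bp_hausdorff := @norm_hausdorff _ R[i]^o;
     bp_sp := fun=> complex_banach R;
     bp_emb := fun=> idfun;
     bp_emb_inj := fun _ _ _ => id;
     bp_emb_continuous := fun _ _ => cvg_id |}.

(* The Banach space X(B) comes with a linear injection pl_seq into the space of
   all sequences int -> B, that is, its elements are B-valued sequences with
   the coordinatewise operations.  A closed subspace of a Banach space is
   presented as a Banach space A with a linear isometry i : A -> B. *)
Record pseudolattice (R : realType) := Pseudolattice {
  pl_sp :> completeNormedModType R[i] -> completeNormedModType R[i];
  pl_seq : forall B, {linear pl_sp B -> (int -> B)};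
  pl_seq_inj : forall B, injective (pl_seq B);
  pl_closed_sub : forall (A B : completeNormedModType R[i])
      (i : {linear A -> B}), (forall a, `|i a| = `|a|) ->
    [set i \o pl_seq A a | a in setT] `<=` range (pl_seq B) /\
    closed (pl_seq B @^-1` [set i \o pl_seq A a | a in setT]);
  pl_bounded : exists2 C : R, 0 < C &
    forall (A B : completeNormedModType R[i]) (T : {linear A -> B}),
      op_bounded T -> forall a : pl_sp A,
      exists2 b : pl_sp B, pl_seq B b = T \o pl_seq A a &
        rnorm b <= C * op_norm T * rnorm a
}.

Section Pseudolattices.
Variable R : realType.

Section OnePseudolattice.
Variables (X : pseudolattice R) (B : completeNormedModType R[i]).

Definition pl_mem : set (int -> B) := range (pl_seq X B).

Definition pl_norm (b : int -> B) : R :=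
  rnorm (xget 0 (pl_seq X B @^-1` [set b])).

Definition pl_bounded_op (T : (int -> B) -> (int -> B)) :=
  exists M : R, forall b, pl_mem b ->
    pl_mem (T b) /\ pl_norm (T b) <= M * pl_norm b.

End OnePseudolattice.

Definition right_shift (B : Type) (b : int -> B) : int -> B :=
  fun n => b (n - 1).

Section OnePair.
Variable B : banach_pair R.

Definition cap_pair : set B :=
  range (bp_emb B false) `&` range (bp_emb B true).

Definition sum_pair : set B :=
  [set bp_emb B false b0 + bp_emb B true b1 | b0 in setT & b1 in setT].

Definition sum_norm (x : B) : R :=
  inf [set t | exists b0 b1,
    x = bp_emb B false b0 + bp_emb B true b1 /\ t = rnorm b0 + rnorm b1].

(* The element of B_j that x is, for x in the image of bp_emb B j. *)
Definition bp_coord (j : bool) (x : B) : bp_sp B j :=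
  xget 0 (bp_emb B j @^-1` [set x]).

Definition exp_weight (j : bool) (b : int -> B) : int -> bp_sp B j :=
  fun n => (expR (j%:R * n%:~R))%:C *: bp_coord j (b n).

Definition laurent_sum (z : R[i]) (b : int -> B) (MN : nat * nat) : B :=
  \sum_(0 <= k < (MN.1 + MN.2).+1)
    z ^ (k%:Z - MN.1%:Z) *: b (k%:Z - MN.1%:Z).

(* The series over all n in int of z^n b_n converges to x in B_0 + B_1, both
   ends of the summation range tending to infinity independently. *)
Definition has_laurent_sum (z : R[i]) (b : int -> B) (x : B) :=
  sum_pair x /\
  (fun MN => sum_norm (laurent_sum z b MN - x)) @ filter_prod \oo \oo
    --> (0 : R).

Definition J0 : set (int -> B) :=
  [set b | (forall n, cap_pair (b n)) /\ finite_set [set n | b n <> 0]].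

Variable X : bool -> pseudolattice R.

Definition J : set (int -> B) :=
  [set b | (forall n, cap_pair (b n)) /\
           forall j, pl_mem (X j) (exp_weight j b)].

Definition J_norm (b : int -> B) : R :=
  Num.max (pl_norm (X false) (exp_weight false b))
          (pl_norm (X true) (exp_weight true b)).

(* The norm of B_{X,s}; meaningful for x in that space, i.e. when some b is as
   in the set below. *)
Definition interp_norm (s : R[i]) (x : B) : R :=
  inf [set J_norm b | b in [set b | J b /\ has_laurent_sum s b x]].

End OnePair.

Arguments J0 : clear implicits.
Arguments J : clear implicits.

Definition annulus : set R[i]^o := [set z | 1 <= rnorm z <= expR 1].

Variable X : bool -> pseudolattice R.

Definition nontrivial := forall s : R[i]^o, interior annulus s ->
  exists2 b : int -> complex_pair R, J _ X b &
  exists2 l : R[i]^o, l != 0 &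
    (laurent_sum s b : nat * nat -> R[i]^o) @ filter_prod \oo \oo --> l.

Definition laurent_compatible := nontrivial /\
  forall (B : banach_pair R) (z : R[i]^o), interior annulus z ->
  exists C : R, forall b : int -> B, J B X b ->
    exists2 x, has_laurent_sum z b x & sum_norm x <= C * J_norm X b.

(* For j = 0 the summation index k < 0 is written k = - (m + 1) with m : nat.
   limn is the limit in B; it exists by ad_decay0 and ad_decay1 below whenever
   b is in X_j(B) and 0 < |rho| < 1. *)
Definition diff_op (B : completeNormedModType R[i]) (j : bool) (rho : R[i])
    (b : int -> B) : int -> B := fun n =>
  if j then limn (series (fun k => rho ^+ k *: b (n + k%:Z + 1)))
  else limn (series (fun m => rho ^+ m.+1 *: b (n - m%:Z))).

Record admits_differentiation : Prop := AdmitsDifferentiation {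
  ad_laurent : laurent_compatible;
  ad_decay0 : forall (B : completeNormedModType R[i]) (r : R), 0 < r < 1 ->
    forall b : int -> B, pl_mem (X false) b ->
    (fun m : nat => r ^+ m * rnorm (b (- m%:Z))) @ \oo --> (0 : R);
  ad_decay1 : forall (B : completeNormedModType R[i]) (r : R), 0 < r < 1 ->
    forall b : int -> B, pl_mem (X true) b ->
    (fun k : nat => r ^+ k * rnorm (b k%:Z)) @ \oo --> (0 : R);
  ad_mem : forall (B : completeNormedModType R[i]) (rho : R[i]),
    0 < `|rho| < 1 -> forall b : int -> B,
    pl_mem (X false) b -> pl_mem (X true) b ->
    forall j, pl_mem (X j) (diff_op j rho b);
  ad_bounded : forall (B : completeNormedModType R[i]) (rho : R[i]),
    0 < `|rho| < 1 ->
    forall j, pl_bounded_op (X j) (@diff_op B j rho)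
}.

End Pseudolattices.

Arguments J0 {R} B _.
Arguments J {R} B X _.
Arguments right_shift {B} b _.

(* Main.v *)
(* The proof is Stafney's argument.  Let b be a sequence of J with sum x at s.
   The sequence u equal to b minus x placed at index 0 has sum 0 at s, so its
   Laurent series can be divided by z - s: there is v in J with
   v_(n-1) - s v_n = u_n.  Indeed v has two expressions,
     v_n = sum_(k >= 0) s^k u_(n+k+1) = - sum_(k < 0) s^k u_(n+k+1),
   the first one controlled in B_1 by D_(1, s/e), the second one in B_0 by
   D_(0, 1/s); they agree because the sum of u is 0.  Approximating v by w in
   J0, the sequence x + (z - s) w lies in J0, has sum x at s, and differs from b
   by (z - s) (v - w), which is small since the shift is bounded. *)

Require Import Defs.
From mathcomp Require Import all_boot all_order all_algebra.
From mathcomp Require Import complex zify lra.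
From mathcomp Require Import all_classical all_reals all_analysis.
Set Implicit Arguments.
Unset Strict Implicit.
Unset Printing Implicit Defensive.
Import Order.TTheory GRing.Theory Num.Theory.
Import numFieldNormedType.Exports.
Local Open Scope classical_set_scope.
Local Open Scope complex_scope.
Local Open Scope ring_scope.

(** * Real-valued norms and moduli over [R[i]] *)

(** The order of [R[i]] compares only numbers with equal imaginary parts, so every epsilon of the
    norm topology is a real number. *)
Lemma gtc0_real (R : realType) (e : R[i]) :
  0 < e -> exists2 d : R, 0 < d & e = d%:C.
Proof.
rewrite ltcE /= => /andP[/eqP e1 e0]; exists (complex.Re e) => //.
by apply/eqP; rewrite eq_complex /= e1 !eqxx.
Qed.

Section RealNorm.
Variables (R : realType) (E : normedModType R[i]).
Implicit Types x y : E.

Lemma rnormE x : `|x| = (rnorm x)%:C.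
Proof.
have := normr_ge0 x; rewrite /rnorm lecE => /andP[/eqP /= h _].
by apply/eqP; rewrite eq_complex /= h !eqxx.
Qed.

Lemma rnorm_ge0 x : 0 <= rnorm x.
Proof. by rewrite -lecR -rnormE; exact: normr_ge0. Qed.

Lemma rnorm0 : rnorm (0 : E) = 0.
Proof. by rewrite /rnorm normr0. Qed.

Lemma rnormD_le x y : rnorm (x + y) <= rnorm x + rnorm y.
Proof. by rewrite -lecR rmorphD /= -!rnormE ler_normD. Qed.

Lemma cvg_rnorm (u : nat -> E) x :
  rnorm (u n - x) @[n --> \oo] --> (0 : R) -> u @ \oo --> x.
Proof.
move=> /cvgrPdist_lt h; apply/cvgrPdist_lt => _ /gtc0_real[e e0 ->].
apply: filterS (h _ e0) => n.
by rewrite sub0r normrN ger0_norm ?rnorm_ge0// distrC rnormE ltcR.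
Qed.

End RealNorm.

Section ComplexModulus.
Variable R : realType.
Implicit Types z w : R[i].
Local Notation modulus z := (rnorm (z : R[i]^o)).

Lemma modulusE z : `|z| = (modulus z)%:C.
Proof. exact: (@rnormE R R[i]^o z). Qed.

Lemma rnormZ (E : normedModType R[i]) z (x : E) :
  rnorm (z *: x) = modulus z * rnorm x.
Proof.
have := normrZ z x.
by rewrite (rnormE x) (rnormE (z *: x)) modulusE -rmorphM => -[].
Qed.

Lemma modulusM z w : modulus (z * w) = modulus z * modulus w.
Proof. exact: (@rnormZ R[i]^o). Qed.

Lemma modulusV z : modulus z^-1 = (modulus z)^-1.
Proof.
by have := normfV z; rewrite !modulusE -fmorphV => -[].
Qed.

Lemma modulus_real (r : R) : modulus r%:C = `|r|.
Proof. by rewrite /rnorm complex_normE /= expr0n /= addr0 sqrtr_sqr. Qed.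

Lemma modulusX z n : modulus (z ^+ n) = modulus z ^+ n.
Proof.
elim: n => [|n ih]; first by rewrite !expr0 (modulus_real 1) normr1.
by rewrite !exprS -ih modulusM.
Qed.

End ComplexModulus.

(** * Geometrically discounted series and the operators [diff_op] *)

(** Absolute convergence: the real series of norms is dominated by a geometric one, and its Cauchy
    criterion transfers to [E], which is complete. *)
Lemma cvg_series_geometric {R : realType} (E : completeNormedModType R[i])
    (u : nat -> E) (C q : R) :
  0 <= C -> 0 <= q < 1 -> (forall k, rnorm (u k) <= C * q ^+ k) ->
  cvgn (series u).
Proof.
move=> C0 /andP[q0 q1] uq.
have : cvgn (series (fun k => rnorm (u k))).
  apply: (@series_le_cvg _ _ (fun k => C * q ^+ k)) => [k|k|//|].
  - exact: rnorm_ge0.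
  - by rewrite mulr_ge0 ?exprn_ge0.
  by apply: is_cvg_geometric_series; rewrite ger0_norm.
move=> /cauchy_cvgP/cauchy_seriesP h; apply/cauchy_cvgP/cauchy_seriesP.
move=> _ /gtc0_real[e e0 ->].
apply: filterS (h _ e0) => n; rewrite ger0_norm; last first.
  by rewrite sumr_ge0 // => i _; exact: rnorm_ge0.
move=> lt; apply: le_lt_trans (ler_norm_sum _ _ _) _.
under eq_bigr do rewrite rnormE.
by rewrite -rmorph_sum ltcR.
Qed.

Section GeometricSeries.
Variables (R : realType) (E : completeNormedModType R[i]).
Local Notation modulus z := (rnorm (z : R[i]^o)).

(** Both sums in [diff_op] have this form, the one for [j = 0] after a reflection. Indexing by the
    starting point [n] exposes a recursion in [n]. *)
Definition discounted_series (rho : R[i]) (f : int -> E) (n : int) :=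
  series (fun k => rho ^+ k *: f (n + k%:Z)).

Lemma discounted_seriesS rho f n N :
  discounted_series rho f n N.+1 = f n + rho *: discounted_series rho f (n + 1) N.
Proof.
rewrite /discounted_series /series /= big_nat_recl// addr0 expr0 scale1r.
congr (_ + _); rewrite scaler_sumr; apply: eq_bigr => k _.
by rewrite scalerA exprS -[k.+1]add1n PoszD addrA.
Qed.

(** Neighbouring starting points differ by one term and an invertible factor [rho], so convergence
    propagates in both directions along the integers. *)
Lemma cvg_discounted_seriesS rho f n l : rho != 0 ->
  discounted_series rho f (n + 1) @ \oo --> l <->
  discounted_series rho f n @ \oo --> f n + rho *: l.
Proof.
move=> rho0; rewrite -(cvg_shiftS (discounted_series rho f n)); split=> h.
  under eq_fun do rewrite discounted_seriesS.
  by apply: cvgD; [exact: cvg_cst|exact: cvgZl_tmp].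
have -> : discounted_series rho f (n + 1) =
    fun N => rho^-1 *: (discounted_series rho f n N.+1 - f n).
  apply/funext => N; rewrite discounted_seriesS [f n + _]addrC addrK.
  by rewrite scalerA mulVf ?scale1r.
have -> : l = rho^-1 *: (f n + rho *: l - f n).
  by rewrite [f n + _]addrC addrK scalerA mulVf ?scale1r.
by apply: cvgZl_tmp; apply: cvgB => //; exact: cvg_cst.
Qed.

Variables (rho : R[i]) (f : int -> E).
Hypothesis rho01 : 0 < `|rho| < 1.
Hypothesis f_decay : forall r : R, 0 < r < 1 ->
  (fun k : nat => r ^+ k * rnorm (f k%:Z)) @ \oo --> (0 : R).

(** With [r] midway between [|rho|] and 1, the decay hypothesis bounds [r^k |f k|] by some [C], so
    the terms are dominated by [C (|rho| / r)^k]. *)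
Lemma is_cvg_discounted_series0 : cvgn (discounted_series rho f 0).
Proof.
move: rho01; rewrite modulusE (ltcR 0) (ltcR _ 1) => /andP[rho0 rho1].
pose r := (1 + modulus rho) / 2.
have r1 : r < 1 by rewrite /r ltr_pdivrMr// mul1r [ltRHS](_ : _ = 1 + 1)// ltrD2l.
have rhor : modulus rho < r.
  by rewrite /r ltr_pdivlMr// mulr_natr mulr2n ltrD2r.
have r0 : 0 < r by exact: lt_trans rhor.
have /f_decay h : 0 < r < 1 by rewrite r0.
have /cvg_seq_bounded/bounded_fun_has_ubound[C hC] :
  cvgn (fun k : nat => r ^+ k * rnorm (f k%:Z)) by apply/cvg_ex; exists 0.
have {}hC k : r ^+ k * rnorm (f k%:Z) <= C by apply: hC; exists k.
apply: (@cvg_series_geometric _ _ _ C (modulus rho / r)).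
- by apply: le_trans (hC 0%N); rewrite expr0 mul1r rnorm_ge0.
- by rewrite divr_ge0 ?ltW//= ltr_pdivrMr// mul1r.
move=> k; rewrite rnormZ modulusX add0r expr_div_n mulrCA.
rewrite ler_wpM2l ?exprn_ge0 ?rnorm_ge0// ler_pdivlMr ?exprn_gt0//.
by rewrite mulrC.
Qed.

Lemma is_cvg_discounted_series n : cvgn (discounted_series rho f n).
Proof.
have rho0 : rho != 0 by rewrite -normr_gt0; case/andP: rho01.
have succ m : cvgn (discounted_series rho f (m + 1)) <->
    cvgn (discounted_series rho f m).
  split=> /cvg_ex[/= l hl]; apply/cvg_ex.
    by exists (f m + rho *: l); apply/cvg_discounted_seriesS.
  exists (rho^-1 *: (l - f m)); apply/cvg_discounted_seriesS => //.
  by rewrite scalerA mulfV// scale1r addrC subrK.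
elim/int_rect: n => [|n ih|n ih]; first exact: is_cvg_discounted_series0.
  by rewrite -addn1 PoszD succ.
by rewrite -succ -addn1 PoszD opprD subrK.
Qed.

(** This one-step recursion is what will make the tails solve [v_(n-1) - s v_n = u_n]. *)
Lemma lim_discounted_series n :
  limn (discounted_series rho f n) =
  f n + rho *: limn (discounted_series rho f (n + 1)).
Proof.
have rho0 : rho != 0 by rewrite -normr_gt0; case/andP: rho01.
apply/cvg_lim; first exact: norm_hausdorff.
by apply/cvg_discounted_seriesS => //; exact: is_cvg_discounted_series.
Qed.

End GeometricSeries.

Lemma diff_op_true (R : realType) (E : completeNormedModType R[i])
    (rho : R[i]) (f : int -> E) (n : int) :
  diff_op true rho f n = limn (discounted_series rho f (n + 1)).
Proof.
rewrite /diff_op /discounted_series; congr (limn (series _)).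
by apply/funext => k; rewrite addrAC.
Qed.

(** For [j = 0] the powers of [rho] start at 1 and the index of [f] decreases, whence the extra
    factor [rho] and the reflection of [f]. *)
Lemma diff_op_false (R : realType) (E : completeNormedModType R[i])
    (rho : R[i]) (f : int -> E) (n : int) :
  cvgn (discounted_series rho (f \o -%R) (- n)) ->
  diff_op false rho f n = rho *: limn (discounted_series rho (f \o -%R) (- n)).
Proof.
move=> h; rewrite /diff_op; apply/cvg_lim; first exact: norm_hausdorff.
rewrite [X in X @ _](_ : _ = rho \*: discounted_series rho (f \o -%R) (- n)).
  exact: cvgZl_tmp.
apply/funext => N; rewrite /discounted_series /series /= scaler_sumr.
by apply: eq_bigr => k _; rewrite scalerA exprS opprD opprK.
Qed.

(** * Linear structure and norm estimates in a pseudolattice *)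

Section PseudolatticeNorm.
Variables (R : realType) (X : pseudolattice R) (E : completeNormedModType R[i]).
Local Notation modulus z := (rnorm (z : R[i]^o)).

Lemma pl_norm_seq (a : X E) : pl_norm X (pl_seq X E a) = rnorm a.
Proof.
rewrite /pl_norm; case: xgetP => [c -> /pl_seq_inj -> //|/(_ a)[]//].
Qed.

Lemma pl_memZD (c : R[i]) (f g : int -> E) :
  pl_mem X f -> pl_mem X g -> pl_mem X (c *: f + g).
Proof. by move=> [a _ <-] [b _ <-]; exists (c *: a + b); rewrite ?linearP. Qed.

Lemma pl_normZD_le (c : R[i]) (f g : int -> E) :
  pl_mem X f -> pl_mem X g ->
  pl_norm X (c *: f + g) <= modulus c * pl_norm X f + pl_norm X g.
Proof.
move=> [a _ <-] [b _ <-]; rewrite -linearP !pl_norm_seq -rnormZ.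
exact: rnormD_le.
Qed.

Lemma pl_mem0 : pl_mem X (0 : int -> E).
Proof. by exists 0; rewrite ?linear0. Qed.

Lemma pl_norm0 : pl_norm X (0 : int -> E) = 0.
Proof. by rewrite -(linear0 (pl_seq X E)) pl_norm_seq rnorm0. Qed.

Lemma pl_memZ (c : R[i]) (f : int -> E) : pl_mem X f -> pl_mem X (c *: f).
Proof. by move=> hf; rewrite -[_ *: _]addr0; exact: pl_memZD pl_mem0. Qed.

Lemma pl_normZ_le (c : R[i]) (f : int -> E) : pl_mem X f ->
  pl_norm X (c *: f) <= modulus c * pl_norm X f.
Proof.
by move=> hf; have := pl_normZD_le c hf pl_mem0; rewrite pl_norm0 !addr0.
Qed.

End PseudolatticeNorm.

(** * The sequence space [J], its norm and its shift *)

Section BanachPair.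
Variables (R : realType) (B : banach_pair R).
Local Notation modulus z := (rnorm (z : R[i]^o)).
Implicit Types (b : int -> B) (x y : B).

Lemma bp_embK j : cancel (bp_emb B j) (bp_coord j).
Proof.
by move=> y; rewrite /bp_coord; case: xgetP => [z _ /bp_emb_inj //|/(_ y)[]].
Qed.

Lemma cap_pair_emb x j : cap_pair x -> range (bp_emb B j) x.
Proof. by move=> [h0 h1]; case: j. Qed.

Lemma bp_coordK j x : cap_pair x -> bp_emb B j (bp_coord j x) = x.
Proof. by move=> /(@cap_pair_emb _ j)[y _ <-]; rewrite bp_embK. Qed.

Lemma cap_pairZD (c : R[i]) x y :
  cap_pair x -> cap_pair y -> cap_pair (c *: x + y).
Proof.
move=> [[x0 _ <-] [x1 _ ex]] [[y0 _ <-] [y1 _ ey]]; split.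
  by exists (c *: x0 + y0); rewrite ?linearP.
by exists (c *: x1 + y1); rewrite ?linearP// ex ey.
Qed.

Lemma cap_pair0 : cap_pair (0 : B).
Proof. by split; exists 0; rewrite ?linear0. Qed.

Lemma bp_coordZD j (c : R[i]) x y : cap_pair x -> cap_pair y ->
  bp_coord j (c *: x + y) = c *: bp_coord j x + bp_coord j y.
Proof.
move=> hx hy; apply: (@bp_emb_inj _ B j).
by rewrite linearP !bp_coordK//; exact: cap_pairZD.
Qed.

Lemma exp_weightZD j (c : R[i]) b b' :
  (forall n, cap_pair (b n)) -> (forall n, cap_pair (b' n)) ->
  exp_weight j (c *: b + b') = c *: exp_weight j b + exp_weight j b'.
Proof.
move=> hb hb'; apply/funext => n; rewrite /exp_weight.
have -> : (c *: b + b') n = c *: b n + b' n by [].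
rewrite bp_coordZD// scalerDr scalerA mulrC -scalerA.
by [].
Qed.

(** Since [e^(jn) = e^j e^(j(n-1))], shift and weight commute up to a constant; boundedness of the
    shift on each [X_j(B_j)] thus passes to [J]. *)
Lemma exp_weight_shift j b : exp_weight j (right_shift b) =
  (expR j%:R)%:C *: right_shift (exp_weight j b).
Proof.
apply/funext => n.
have -> : ((expR j%:R)%:C *: right_shift (exp_weight j b)) n =
  (expR j%:R)%:C *: exp_weight j b (n - 1) by [].
rewrite /exp_weight /right_shift scalerA -rmorphM -expRD.
by rewrite intrB mulrBr mulr1 [j%:R + _]addrC subrK.
Qed.

Variable X : bool -> pseudolattice R.

Lemma J_ZD (c : R[i]) b b' : J B X b -> J B X b' -> J B X (c *: b + b').
Proof.
move=> [cb mb] [cb' mb']; split=> [n|j]; first exact: cap_pairZD.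
by rewrite exp_weightZD//; exact: pl_memZD.
Qed.

Lemma pl_norm_le_J_norm j b : pl_norm (X j) (exp_weight j b) <= J_norm X b.
Proof. by rewrite le_max; case: j; rewrite lexx ?orbT. Qed.

Lemma J_norm_le b (C : R) :
  (forall j, pl_norm (X j) (exp_weight j b) <= C) -> J_norm X b <= C.
Proof. by move=> h; rewrite ge_max !h. Qed.

Lemma J_norm_ge0 b : 0 <= J_norm X b.
Proof. exact: le_trans (rnorm_ge0 _) (pl_norm_le_J_norm true b). Qed.

Lemma J_normZD_le (c : R[i]) b b' : J B X b -> J B X b' ->
  J_norm X (c *: b + b') <= modulus c * J_norm X b + J_norm X b'.
Proof.
move=> [cb mb] [cb' mb']; apply: J_norm_le => j; rewrite exp_weightZD//.
apply: le_trans (pl_normZD_le _ (mb j) (mb' j)) _.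
by rewrite lerD ?ler_wpM2l ?rnorm_ge0 ?pl_norm_le_J_norm.
Qed.

Hypothesis shift_bounded :
  forall j, pl_bounded_op (X j) (B := bp_sp B j) right_shift.

Lemma J_shift b : J B X b -> J B X (right_shift b).
Proof.
move=> [cb mb]; split=> [n|j]; first exact: cb.
rewrite exp_weight_shift; apply: pl_memZ.
by have [M /(_ _ (mb j))[]] := shift_bounded j.
Qed.

Lemma J_norm_shift_le :
  exists C : R, forall b, J B X b -> J_norm X (right_shift b) <= C * J_norm X b.
Proof.
have /choice[M hM] := shift_bounded.
(* The factors [e^j] come from [exp_weight_shift]; the absolute values are taken because a bound
   [M j] may be negative. *)
exists (Num.max (expR 0 * `|M false|) (expR 1 * `|M true|)) => b [cb mb].
apply: J_norm_le => j; rewrite exp_weight_shift.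
have [ms ns] := hM j _ (mb j).
apply: le_trans (pl_normZ_le _ ms) _; rewrite modulus_real ger0_norm ?expR_ge0//.
apply: (@le_trans _ _ (expR j%:R * `|M j| * pl_norm (X j) (exp_weight j b))).
  rewrite -mulrA ler_wpM2l ?expR_ge0//; apply: le_trans ns _.
  by rewrite ler_wpM2r ?rnorm_ge0// ler_norm.
apply: ler_pM; rewrite ?pl_norm_le_J_norm ?rnorm_ge0 ?mulr_ge0 ?expR_ge0//.
by rewrite le_max; case: j {ms ns}; rewrite lexx ?orbT.
Qed.

End BanachPair.

(** * Convergence in the sum space and in the ambient space *)

Lemma cvgD_topological (R : realType) (V : topologicalLmodType R[i]) (T : Type)
    (F : set_system T) (f g : T -> V) (a b : V) : Filter F ->
  f @ F --> a -> g @ F --> b -> (fun t => f t + g t) @ F --> a + b.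
Proof.
move=> FF fa gb.
by apply: continuous2_cvg => //; exact: (add_continuous (a, b)).
Qed.

Section SumSpace.
Variables (R : realType) (B : banach_pair R).
Implicit Types x y : B.

Lemma cap_sum_pair x : cap_pair x -> sum_pair x.
Proof.
by move=> [[x0 _ <-] _]; exists x0 => //; exists 0; rewrite // linear0 addr0.
Qed.

Lemma sum_norm_ge0 x : 0 <= sum_norm x.
Proof.
rewrite /sum_norm; set S := [set _ | _].
have lb0 : lbound S 0.
  by move=> _ [b0 [b1 [_ ->]]]; rewrite addr_ge0 ?rnorm_ge0.
have [->|/set0P S0] := eqVneq S set0; first by rewrite inf0.
exact: lb_le_inf.
Qed.

Lemma sum_norm0 : sum_norm (0 : B) = 0.
Proof.
apply/eqP; rewrite eq_le sum_norm_ge0 andbT; apply: ge_inf.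
  by exists 0 => _ [b0 [b1 [_ ->]]]; rewrite addr_ge0 ?rnorm_ge0.
by exists 0, 0; rewrite !linear0 !rnorm0 !addr0.
Qed.

(** Almost optimal decompositions have components tending to 0 in [B_0] and [B_1], and the
    embeddings are continuous. *)
Lemma cvg_sum_norm0 (y : nat -> B) : (forall k, sum_pair (y k)) ->
  (fun k => sum_norm (y k)) @ \oo --> (0 : R) -> y @ \oo --> (0 : B).
Proof.
move=> ysum y0.
(* The infimum in [sum_norm] may not be attained; the slack [1/(k+1)] provides a decomposition and
   still tends to 0. *)
have split_y k : exists p : bp_sp B false * bp_sp B true,
    y k = bp_emb B false p.1 + bp_emb B true p.2 /\
    rnorm p.1 + rnorm p.2 < sum_norm (y k) + k.+1%:R^-1.
  have : has_inf [set t | exists b0 b1,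
      y k = bp_emb B false b0 + bp_emb B true b1 /\ t = rnorm b0 + rnorm b1].
    split; last by exists 0 => _ [b0 [b1 [_ ->]]]; rewrite addr_ge0 ?rnorm_ge0.
    have [b0 _ [b1 _ e]] := ysum k.
    by exists (rnorm b0 + rnorm b1), b0, b1.
  have k0 : 0 < k.+1%:R^-1 :> R by rewrite invr_gt0.
  by move=> /(inf_adherent k0)[_ [b0 [b1 [e ->]]] lt]; exists (b0, b1).
have [p /= hp] := choice split_y.
have small : (fun k => sum_norm (y k) + k.+1%:R^-1) @ \oo --> (0 : R).
  by rewrite -[0]addr0; apply: cvgD => //; exact: cvg_harmonic.
have p1 : (fst \o p) @ \oo --> (0 : bp_sp B false).
  apply: cvg_rnorm; apply: (squeeze_cvgr _ (cvg_cst 0) small).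
  near=> k; rewrite subr0 rnorm_ge0 /=; apply: le_trans (ltW (hp k).2).
  by rewrite lerDl rnorm_ge0.
have p2 : (snd \o p) @ \oo --> (0 : bp_sp B true).
  apply: cvg_rnorm; apply: (squeeze_cvgr _ (cvg_cst 0) small).
  near=> k; rewrite subr0 rnorm_ge0 /=; apply: le_trans (ltW (hp k).2).
  by rewrite lerDr rnorm_ge0.
have -> : y = fun k => bp_emb B false (p k).1 + bp_emb B true (p k).2.
  by apply/funext => k; rewrite (hp k).1.
rewrite -[X in _ --> X]addr0 -{1}(linear0 (bp_emb B false)).
rewrite -(linear0 (bp_emb B true)).
apply: cvgD_topological.
  exact: (continuous_cvg _ (@bp_emb_continuous _ B false 0) p1).
exact: (continuous_cvg _ (@bp_emb_continuous _ B true 0) p2).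
Unshelve. all: by end_near. Qed.

End SumSpace.

(** * Laurent partial sums and telescoping *)

Section LaurentSums.
Variables (R : realType) (B : banach_pair R) (z : R[i]).
Hypothesis z0 : z != 0.
Implicit Types (b w : int -> B).

Lemma laurent_sum_split b M N : laurent_sum z b (M, N) =
  \sum_(0 <= k < N.+1) z ^+ k *: b k%:Z +
  \sum_(0 <= k < M) z^-1 ^+ k.+1 *: b (- k.+1%:Z).
Proof.
rewrite /laurent_sum /= (@big_cat_nat _ _ _ M)//=; last first.
  by rewrite -addnS leq_addr.
rewrite addrC; congr (_ + _).
  rewrite -{1}[M]add0n big_addn -addnS addKn.
  by apply: eq_bigr => k _; rewrite PoszD addrK.
rewrite big_nat_rev /= add0n; apply: eq_big_nat => k /= kM.
have -> : (M - k.+1)%N%:Z - M%:Z = - k.+1%:Z.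
  by rewrite -subzn// addrAC subrr add0r.
by rewrite exprVn.
Qed.

Lemma laurent_sumZD (c : R[i]) b b' MN :
  laurent_sum z (c *: b + b') MN = c *: laurent_sum z b MN + laurent_sum z b' MN.
Proof.
rewrite /laurent_sum scaler_sumr -big_split; apply: eq_bigr => k _.
rewrite [X in _ *: X = _](_ : _ =
  c *: b (k%:Z - MN.1%:Z) + b' (k%:Z - MN.1%:Z))//.
by rewrite scalerDr !scalerA mulrC.
Qed.

(** The sequence has as its Laurent series in a variable [zeta] the series of [w] times [zeta - z].
    At [zeta = z] its terms are [z^n w_(n-1) - z^(n+1) w_n], so only the two ends survive. *)
Lemma laurent_sum_telescope w M N :
  laurent_sum z (- z *: w + right_shift w) (M, N) =
  z ^ (- M%:Z) *: w (- M%:Z - 1) - z ^+ N.+1 *: w N%:Z.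
Proof.
pose f k := - (z ^ (k%:Z - M%:Z) *: w (k%:Z - M%:Z - 1)).
rewrite /laurent_sum /= (@telescope_sumr_eq _ _ _ f)// => [|k _].
  rewrite [LHS]addrC /f sub0r opprK; congr (_ - _ *: w _); last by lia.
  by rewrite -addnS PoszD [M%:Z + _]addrC addrK.
rewrite /f opprK [RHS]addrC [LHS](_ : _ =
  z ^ (k%:Z - M%:Z) *: (- z *: w (k%:Z - M%:Z) + w (k%:Z - M%:Z - 1)))//.
rewrite scalerDr [LHS]addrC scalerA mulrN scaleNr.
have -> : k.+1%:Z - M%:Z = (k%:Z - M%:Z) + 1 by rewrite -addn1 PoszD addrAC.
by rewrite addrK [z ^ (_ + 1)]expfzDr// expr1z.
Qed.

End LaurentSums.

(** * Finitely supported sequences *)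

Lemma finite_support_bound (V : zmodType) (w : int -> V) :
  finite_set [set n | w n <> 0] ->
  exists K : nat, forall n : int, (K < `|n|)%N -> w n = 0.
Proof.
move=> /finite_seqP[t ht]; exists (\max_(n <- t) `|n|)%N => n; rewrite ltnNge.
move=> /negP h; apply: contrapT => wn; apply: h.
have nt : n \in t by have : [set` t] n by rewrite -ht.
exact: (@leq_bigmax_seq _ t xpredT (fun n => `|n|%N) n nt).
Qed.

Section FiniteSequences.
Variables (R : realType) (B : banach_pair R).
Local Notation modulus z := (rnorm (z : R[i]^o)).
Implicit Types (b w : int -> B) (x : B).

(** The coefficients of the constant Laurent series [x]. *)
Definition single x : int -> B := fun n => if n == 0 then x else 0.

Lemma J0_single x : cap_pair x -> J0 B (single x).
Proof.
move=> hx; split=> [n|].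
  by rewrite /single; case: eqP => // _; exact: cap_pair0.
apply: (@sub_finite_set _ _ [set 0]) => [n|]; last exact: finite_set1.
by rewrite /single /=; case: eqP.
Qed.

Lemma laurent_sum_single (z : R[i]) x MN :
  z != 0 -> laurent_sum z (single x) MN = x.
Proof.
case: MN => M N z0; rewrite laurent_sum_split// big_nat_recl//= expr0 scale1r.
rewrite [X in _ + X + _]big1 ?addr0 => [|k _]; last by rewrite scaler0.
by rewrite big1 ?addr0 => // k _; rewrite /single oppr_eq0 scaler0.
Qed.

Lemma J0_ZD (c : R[i]) b b' : J0 B b -> J0 B b' -> J0 B (c *: b + b').
Proof.
move=> [cb fb] [cb' fb']; split=> [n|]; first exact: cap_pairZD.
apply: (@sub_finite_set _ _ ([set n | b n <> 0] `|` [set n | b' n <> 0])).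
  move=> n /=; rewrite -not_andP; apply: contra_not => -[bn bn'].
  by rewrite [LHS](_ : _ = c *: b n + b' n)// bn bn' scaler0 addr0.
by rewrite finite_setU.
Qed.

Lemma J0_shift b : J0 B b -> J0 B (right_shift b).
Proof.
move=> [cb fb]; split=> [n|]; first exact: cb.
apply: (@sub_finite_set _ _ ((fun n => n + 1) @` [set n | b n <> 0])).
  by move=> n hn; exists (n - 1); rewrite ?subrK.
exact: finite_image.
Qed.

(** Once [M] and [N] exceed a bound for the support of [w], both boundary terms of the telescoping
    sum vanish and the partial sums equal [x] exactly. *)
Lemma has_laurent_sum_telescope (z : R[i]) w x : z != 0 -> cap_pair x ->
  J0 B w -> has_laurent_sum z (1 *: single x + (- z *: w + right_shift w)) x.
Proof.
move=> z0 hx [_ /finite_support_bound[K hK]].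
split; first exact: cap_sum_pair.
apply: cvg_near_cst.
exists ([set m | (K < m)%N], [set n | (K < n)%N]).
  by split; exists K.+1.
move=> [M N] /= [KM KN].
rewrite laurent_sumZD laurent_sum_single// laurent_sum_telescope// scale1r.
rewrite (hK N%:Z)// (hK (- M%:Z - 1)); last by lia.
by rewrite !scaler0 subrr addr0 subrr sum_norm0.
Qed.

End FiniteSequences.

(** * Interior points of the annulus *)

(** Near an interior point [s] the dilates [(1 - r) s] and [(1 + r) s] remain in the annulus, which
    makes both bounds on [|s|] strict. *)
Lemma annulus_interior (R : realType) (s : R[i]^o) :
  interior (@annulus R) s -> 1 < rnorm s < expR 1.
Proof.
move=> sint; have /andP[s1 se] := interior_subset sint.
have s0 : 0 < rnorm s by exact: lt_le_trans s1.
move: sint => /nbhs_ballP[e /= e0 he].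
have [d d0 hd] : exists2 d : R, 0 < d & forall t : R[i]^o,
    rnorm (s - t) < d -> annulus t.
  move/gtc0_real: e0 he => [d d0 ->] hd; exists d => // t st.
  by apply: hd; rewrite -ball_normE /= rnormE ltcR.
(* The first entry keeps both dilates within distance [d] of [s]; the second makes [1 - r]
   positive. *)
pose r := Num.min (d / rnorm s / 2) (1 / 2).
have r0 : 0 < r by rewrite lt_min !divr_gt0.
have r1 : r < 1 by rewrite /r gt_min; apply/orP; right; lra.
have rd : r * rnorm s < d.
  rewrite -ltr_pdivlMr// gt_min; apply/orP; left.
  by have := divr_gt0 d0 s0; lra.
have scale (c : R) : `|c - 1| = r -> 1 <= `|c| * rnorm s <= expR 1.
  move=> hc; rewrite -modulus_real -modulusM; apply: hd.
  rewrite -{1}[s]mul1r -mulrBl modulusM.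
  by rewrite -(rmorph1 (@real_complex R)) -rmorphB modulus_real distrC hc.
apply/andP; split.
  have := @scale (1 - r).
  rewrite addrAC subrr add0r normrN !gtr0_norm ?subr_gt0//.
  move=> /(_ erefl) /andP[h _].
  by apply: (le_lt_trans h); rewrite gtr_pMl// ltrBlDr ltrDl.
have := @scale (1 + r).
rewrite addrAC subrr add0r !gtr0_norm ?addr_gt0// => /(_ erefl) /andP[_ h].
by apply: (lt_le_trans _ h); rewrite ltr_pMl// ltrDl.
Qed.

(** * Division of a Laurent series by [z - s] *)

Section LaurentDivision.
Variables (R : realType) (X : bool -> pseudolattice R) (B : banach_pair R).
Hypothesis hX : admits_differentiation X.
Local Notation modulus z := (rnorm (z : R[i]^o)).
Variable s : R[i].
Hypothesis s_annulus : 1 < modulus s < expR 1.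
Variable u : int -> B.
Hypotheses (uJ : J B X u) (u_sum : has_laurent_sum s u 0).

Let s0 : s != 0.
Proof.
apply/eqP => e; move: s_annulus; rewrite e.
by rewrite [modulus 0]rnorm0 ltNge ler01.
Qed.

Let u_cap n : cap_pair (u n). Proof. by case: uJ => h _; exact: h. Qed.

Let w j := exp_weight j u.

(** The factor [1/e] compensates the weight [e^n] built into [w true]; [|s| < e] then gives
    [|rho1| < 1]. *)
Let rho1 : R[i] := s * (expR (-1))%:C.

Let sV_unit : 0 < `|s^-1| < 1.
Proof.
have /andP[s1 _] := s_annulus.
rewrite normr_gt0 invr_eq0 s0 /= modulusE modulusV (ltcR _ 1).
by rewrite invf_lt1// (lt_trans _ s1).
Qed.

Let rho1_unit : 0 < `|rho1| < 1.
Proof.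
have /andP[s1 se] := s_annulus.
rewrite modulusE modulusM modulus_real ger0_norm ?expR_ge0//.
rewrite (ltcR 0) (ltcR _ 1) mulr_gt0 ?expR_gt0 ?(lt_trans _ s1)//=.
by rewrite expRN ltr_pdivrMr ?expR_gt0// mul1r.
Qed.

Let decay0 (r : R) : 0 < r < 1 ->
  (fun k : nat => r ^+ k * rnorm ((w false \o -%R) k%:Z)) @ \oo --> (0 : R).
Proof. by move=> r01; apply: (ad_decay0 hX r01); case: uJ. Qed.

Let decay1 (r : R) : 0 < r < 1 ->
  (fun k : nat => r ^+ k * rnorm (w true k%:Z)) @ \oo --> (0 : R).
Proof. by move=> r01; apply: (ad_decay1 hX r01); case: uJ. Qed.

(** Unfolded, [d0 n] is the sum of [s^k u_(n+k+1)] over [k < 0], taken in [B_0]. The same sum over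
    [k >= 0], taken in [B_1], is [g1 n], and [d1 n] is [e^(n+1)] times it. *)
Let d0 : int -> bp_sp B false := diff_op false s^-1 (w false).
Let d1 : int -> bp_sp B true := diff_op true rho1 (w true).
Let g1 n : bp_sp B true := (expR (- (n + 1)%:~R))%:C *: d1 n.

Let wE j n : w j n = (expR (j%:R * n%:~R))%:C *: bp_coord j (u n).
Proof. by []. Qed.

Let d0E n :
  d0 n = s^-1 *: limn (discounted_series s^-1 (w false \o -%R) (- n)).
Proof.
rewrite /d0 diff_op_false//.
exact: (is_cvg_discounted_series sV_unit decay0).
Qed.

Let d0_rec n : d0 (n - 1) = s *: d0 n - bp_coord false (u n).
Proof.
rewrite [d0 n]d0E (lim_discounted_series sV_unit decay0).
rewrite scalerA mulfV// scale1r d0E.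
by rewrite opprB [1 - n]addrC addrAC /= opprK wE mul0r expR0 scale1r subrr add0r.
Qed.

Let g1_rec n : g1 (n - 1) = bp_coord true (u n) + s *: g1 n.
Proof.
rewrite /g1 subrK /d1 diff_op_true subrK (lim_discounted_series rho1_unit decay1).
rewrite -diff_op_true wE mul1r scalerDr !scalerA -rmorphM -expRD addNr expR0.
rewrite scale1r; congr (_ + _ *: _).
rewrite mulrC /rho1 -mulrA -rmorphM -expRD; congr (s * (expR _)%:C).
by rewrite intrD opprD addrC.
Qed.

(** The recursions of [d0] and [g1] contain [u n] with opposite signs, so the sum of the two tails
    obeys a homogeneous recursion. *)
Let cancel_rec n :
  bp_emb B false (d0 (n - 1)) + bp_emb B true (g1 (n - 1)) =
  s *: (bp_emb B false (d0 n) + bp_emb B true (g1 n)).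
Proof.
rewrite d0_rec g1_rec linearB linearD !linearZ /= !bp_coordK//.
by rewrite scalerDr addrA subrK.
Qed.

(** At index -1 the tails are the negative and nonnegative halves of the Laurent series of [u] at
    [s], whose sum is 0. The halves converge in different spaces, so limits are compared in the
    Hausdorff ambient space. *)
Let cancel_base : bp_emb B false (d0 (-1)) + bp_emb B true (g1 (-1)) = 0.
Proof.
have partial k : laurent_sum s u (k, k) =
    bp_emb B true (discounted_series rho1 (w true) 0 k.+1) +
    bp_emb B false (s^-1 *: discounted_series s^-1 (w false \o -%R) 1 k).
  rewrite laurent_sum_split// /discounted_series /series /= scaler_sumr.
  rewrite !linear_sum.
  congr (_ + _); apply: eq_bigr => i _.
    rewrite add0r wE mul1r scalerA linearZ /= bp_coordK//; congr (_ *: _).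
    rewrite /rho1 exprMn -mulrA -rmorphXn -expRM_natl -rmorphM -expRD.
    by rewrite mulrN1 addNr expR0 mulr1.
  by rewrite scalerA -exprS linearZ /= wE mul0r expR0 scale1r bp_coordK.
have cvg0 : (fun k => laurent_sum s u (k, k)) @ \oo --> (0 : B).
  apply: cvg_sum_norm0 => [k|].
    rewrite partial; set p1 := discounted_series _ _ _ _; set p0 := _ *: _.
    by exists p0 => //; exists p1; rewrite // addrC.
  have [_] := u_sum; under eq_fun do rewrite subr0; move=> h.
  (* Convergence with independent ends implies convergence of the symmetric partial sums. *)
  have diag : (fun k : nat => (k, k)) @ \oo --> filter_prod \oo \oo.
    move=> A [[P Q] /= [oP oQ] PQ]; apply: filterS2 oP oQ => k Pk Qk.
    exact: (PQ (k, k)).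
  exact: (cvg_comp _ _ diag h).
have lim1 : (fun k => bp_emb B true (discounted_series rho1 (w true) 0 k.+1))
    @ \oo --> bp_emb B true (g1 (-1)).
  have -> : g1 (-1) = limn (discounted_series rho1 (w true) 0).
    by rewrite /g1 /d1 diff_op_true addNr oppr0 expR0 scale1r.
  apply: (continuous_cvg _ (@bp_emb_continuous _ B true _)).
  rewrite (cvg_shiftS (discounted_series rho1 (w true) 0)).
  exact: (is_cvg_discounted_series rho1_unit decay1).
have lim0 : (fun k =>
      bp_emb B false (s^-1 *: discounted_series s^-1 (w false \o -%R) 1 k))
    @ \oo --> bp_emb B false (d0 (-1)).
  rewrite d0E opprK; apply: (continuous_cvg _ (@bp_emb_continuous _ B false _)).
  by apply: cvgZl_tmp; exact: (is_cvg_discounted_series sV_unit decay0).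
rewrite addrC; apply: (cvg_unique (@bp_hausdorff _ B) _ cvg0).
rewrite (funext partial); exact: cvgD_topological.
Qed.

Let cancel_emb n : bp_emb B false (d0 n) + bp_emb B true (g1 n) = 0.
Proof.
(* Writing the index as [m - 1] starts the induction at -1; the upward step divides by [s]. *)
have P m : bp_emb B false (d0 (m - 1)) + bp_emb B true (g1 (m - 1)) = 0.
  elim/int_rect: m => [|m ih|m ih]; first by rewrite sub0r cancel_base.
    move: ih; rewrite cancel_rec => /eqP.
    by rewrite scaler_eq0 (negPf s0) /= -addn1 PoszD addrK => /eqP.
  rewrite cancel_rec (_ : - m.+1%:Z = - m%:Z - 1) ?ih ?scaler0//.
  by rewrite -addn1 PoszD opprD.
by rewrite -[n](addrK 1) P.
Qed.

(** As the tails cancel, [g1 n] and [- d0 n] are one ambient element, which therefore lies in both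
    spaces. Its weighted forms are multiples of [d1] and [d0], which [ad_bounded] places in the
    pseudolattices. *)
Lemma laurent_divide :
  exists2 v, J B X v & - s *: v + right_shift v = u.
Proof.
pose v n := bp_emb B true (g1 n).
have vE n : v n = bp_emb B false (- d0 n).
  by apply/eqP; rewrite linearN -addr_eq0 addrC cancel_emb.
have [m0 m1] : pl_mem (X false) d0 /\ pl_mem (X true) d1.
  have [_ mw] := uJ.
  have [M0 /(_ _ (mw false))[? _]] :=
    ad_bounded hX (bp_sp B false) sV_unit false.
  have [M1 /(_ _ (mw true))[? _]] :=
    ad_bounded hX (bp_sp B true) rho1_unit true.
  by [].
exists v.
  split=> [n|[]].
  - by split; [rewrite vE; exists (- d0 n)|exists (g1 n)].
  (* The weight [e^n] against the factor [e^(-(n+1))] of [g1] leaves the constant [1/e]. *)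
  - rewrite (_ : exp_weight true v = (expR (-1))%:C *: d1); first exact: pl_memZ.
    apply/funext => n; rewrite /exp_weight /v bp_embK /g1 scalerA -rmorphM -expRD.
    by rewrite mul1r intrD opprD addrA subrr add0r.
  rewrite (_ : exp_weight false v = -1 *: d0); first exact: pl_memZ.
  apply/funext => n.
  by rewrite /exp_weight vE bp_embK mul0r expR0 scale1r -scaleN1r.
apply/funext => n.
rewrite [LHS](_ : _ = - s *: v n + v (n - 1))// /v g1_rec linearD bp_coordK//.
by rewrite [bp_emb B true (s *: g1 n)]linearZ scaleNr addrCA addNr addr0.
Qed.

End LaurentDivision.

(** * Comparison of the two infima *)

(** If [S] is empty, so is [T]. Otherwise the approximation gives a point of [T], so both infima are
    genuine, and [inf T <= t + eps] for each [t] in [S]. *)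
Lemma inf_eq_approx (R : realType) (S T : set R) : T `<=` S -> has_lbound S ->
  (forall c, S c -> forall eps, 0 < eps -> exists2 d, T d & d <= c + eps) ->
  inf S = inf T.
Proof.
move=> TS Slb approx.
have [S0|/set0P[c Sc]] := eqVneq S set0.
  by congr inf; apply/seteqP; split=> // c; rewrite S0.
have [d Td _] := approx _ Sc 1 ltr01.
have Tlb : has_lbound T by case: Slb => m hm; exists m => t /TS; exact: hm.
apply/eqP; rewrite eq_le; apply/andP; split.
  by apply: lb_le_inf; [exists d|move=> t /TS; exact: ge_inf].
apply: lb_le_inf; first by exists c.
move=> t St; apply/ler_addgt0Pr => eps e0.
have [t' Tt' le] := approx _ St _ e0.
by apply: le_trans le; exact: ge_inf.
Qed.

Unset Implicit Arguments.

Theorem theorem18 (R : realType) (X : bool -> pseudolattice R)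
    (B : banach_pair R) (hX : admits_differentiation X)
    (hJ0 : J0 B `<=` J B X)
    (hdense : forall b, J B X b -> forall eps : R, 0 < eps ->
      exists2 a, J0 B a & J_norm X (b \- a) < eps)
    (hS : forall j, pl_bounded_op (X j) (B := bp_sp B j) right_shift)
    (x : B) (hx : cap_pair x) (s : R[i]^o) (hs : interior (@annulus R) s) :
  interp_norm X s x =
  inf [set J_norm X b | b in [set b | has_laurent_sum s b x /\ J0 B b]].
Proof.
have s_annulus := annulus_interior hs.
have s0 : (s : R[i]) != 0.
  apply/eqP => e; move: s_annulus; rewrite e.
  by rewrite rnorm0 ltNge ler01.
apply: inf_eq_approx.
- by move=> _ [b [hb /hJ0 bJ] <-]; exists b.
- by exists 0 => _ [b _ <-]; exact: J_norm_ge0.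
move=> _ [b [bJ [_ b_sum]] <-] eps eps0.
have xJ0 := J0_single hx; have xJ := hJ0 _ xJ0.
pose u := -1 *: single x + b.
have uJ : J B X u by exact: J_ZD.
have u_sum : has_laurent_sum (s : R[i]) u 0.
  split; first exact: cap_sum_pair (cap_pair0 B).
  apply: cvg_trans b_sum; apply: near_eq_cvg; near=> MN.
  by rewrite laurent_sumZD laurent_sum_single// scaleN1r addrC subr0.
have [v vJ uE] := laurent_divide hX s_annulus uJ u_sum.
have [C hC] := J_norm_shift_le hS.
(* [D] bounds multiplication by [z - s] on [J]; dividing by [D + 1] below avoids a zero
   denominator. *)
pose D := rnorm s + `|C|.
have D0 : 0 <= D by rewrite addr_ge0 ?rnorm_ge0.
have D1 : 0 < D + 1 by rewrite ltr_wpDl.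
have [w wJ0 vw] := hdense v vJ (eps / (D + 1)) (divr_gt0 eps0 D1).
pose c : int -> B := -1 *: w + v.
have cJ : J B X c by apply: J_ZD => //; exact: hJ0.
have c_lt : J_norm X c < eps / (D + 1).
  rewrite (_ : c = v \- w)//; apply/funext => n.
  by rewrite [LHS](_ : _ = -1 *: w n + v n)// scaleN1r addrC.
exists (J_norm X (1 *: single x + (- s *: w + right_shift w))).
  exists (1 *: single x + (- s *: w + right_shift w)) => //.
  split; first exact: has_laurent_sum_telescope.
  by apply: J0_ZD => //; apply: J0_ZD => //; exact: J0_shift.
(* The coefficients of [(z - s)(v - w)], by which [b] exceeds the chosen sequence. *)
pose t := - s *: c + right_shift c.
have tJ : J B X t by apply: J_ZD => //; exact: J_shift.
have t_le : J_norm X t <= eps.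
  apply: (le_trans (J_normZD_le _ cJ (J_shift hS cJ))).
  rewrite (_ : rnorm _ = rnorm s); last by rewrite /rnorm normrN.
  apply: (@le_trans _ _ (D * J_norm X c)).
    rewrite mulrDl lerD2l; apply: (le_trans (hC _ cJ)).
    by rewrite ler_wpM2r ?J_norm_ge0 ?ler_norm.
  apply: (le_trans (ler_wpM2l D0 (ltW c_lt))).
  by rewrite mulrA ler_pdivrMr// mulrC ler_wpM2l ?ltW// ltrDl.
(* Since [b] is [x + (z - s) v], the chosen sequence is [b - t]; the identity is checked at each
   index. *)
have -> : 1 *: single x + (- s *: w + right_shift w) = -1 *: t + b.
  rewrite (_ : b = single x + u); last by rewrite /u scaleN1r addrA subrr add0r.
  rewrite -uE; apply/funext => n.
  rewrite [LHS](_ : _ = 1 *: single x n + (- s *: w n + w (n - 1)))//.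
  rewrite [RHS](_ : _ = -1 *: (- s *: (-1 *: w n + v n) +
    (-1 *: w (n - 1) + v (n - 1))) + (single x n + (- s *: v n + v (n - 1))))//.
  have L : - s *: (- w n + v n) + (- w (n - 1) + v (n - 1)) =
      (- s *: v n + v (n - 1)) - (- s *: w n + w (n - 1)).
    by rewrite scalerDr scalerN addrACA [LHS]addrC opprD.
  rewrite scale1r !scaleN1r L opprB [RHS]addrC -addrA.
  by rewrite [X in _ = _ + X]addrC subrK.
apply: (le_trans (J_normZD_le _ tJ bJ)).
rewrite addrC lerD2l (_ : rnorm _ = 1) ?mul1r//.
by rewrite /rnorm normrN normr1.
Unshelve. all: by end_near. Qed.
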